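(* Let $F\in\mathcal F$ and $z\in\mathbb R^n$. The gradient at $F$ of the map $F\mapsto J_\alpha(F,z)$ is $$\nabla_F J_\alpha(F,z)=2P_{12}^T S_{11}+2P_{22}S_{12}^T,$$ where $S$ and $P$ are the solutions in $\mathbb S^{n+m}$ of $$S=\alpha A_F S A_F^T+\begin{bmatrix} I_n\\ F\end{bmatrix} zz^T\begin{bmatrix} I_n\\ F\end{bmatrix}^T \qquad\text{and}\qquad \alpha A_F^T P A_F-P+\Lambda=0,$$ respectively.
   Context: $\mathbb S^{p}$ is the set of symmetric real $p\times p$ matrices. The linear system is $x(k+1)=Ax(k)+Bu(k)$ with $A\in\mathbb R^{n\times n}$, $B\in\mathbb R^{n\times m}$. The weights $Q\in\mathbb S^n$, $Q\succeq 0$, and $R\in\mathbb S^m$, $R\succ 0$, are fixed, and $\Lambda:=\begin{bmatrix} Q&0\\0&R\end{bmatrix}$. The discount factor is $\alpha\in(0,1]$. $\rho(\cdot)$ denotes the spectral radius and $\mathcal F:=\{F\in\mathbb R^{m\times n}:\rho(A+BF)<1\}$ is the set of stabilizing gains. For $F\in\mathbb R^{m\times n}$, $$A_F:=\begin{bmatrix} A&B\\ FA&FB\end{bmatrix}\in\mathbb R^{(n+m)\times(n+m)}.$$ $x(k;F,z)$ is the solution at time $k$ of $x(k+1)=(A+BF)x(k)$, $x(0)=z$, and $$J_\alpha(F,z):=\sum_{k=0}^\infty \alpha^k\begin{bmatrix} x(k;F,z)\\ Fx(k;F,z)\end{bmatrix}^T\Lambda\begin{bmatrix} x(k;F,z)\\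 Fx(k;F,z)\end{bmatrix}.$$ A matrix $M\in\mathbb S^{n+m}$ is partitioned as $M=\begin{bmatrix} M_{11}&M_{12}\\ M_{12}^T&M_{22}\end{bmatrix}$ with $M_{11}\in\mathbb S^n$, $M_{12}\in\mathbb R^{n\times m}$, $M_{22}\in\mathbb S^m$. The gradient $\nabla_F f(F)\in\mathbb R^{m\times n}$ of a scalar function $f$ is the matrix $X$ such that the differential is $df=\mathrm{Tr}(dF^T X)$. *)

(* Defs.v *)
From HB Require Import structures.
From mathcomp Require Import all_boot all_order all_algebra.
From mathcomp Require Import complex.
From mathcomp Require Import all_classical all_reals all_analysis.

(* The field of real numbers is called K: R denotes the input weight. *)

Set Implicit Arguments.
Unset Strict Implicit.
Unset Printing Implicit Defensive.

Import Order.TTheory GRing.Theory Num.Theory.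
Import numFieldNormedType.Exports.

Local Open Scope classical_set_scope.
Local Open Scope ring_scope.

Definition psdmx (K : realType) (p : nat) (M : 'M[K]_p) : Prop :=
  M \is symmetricmx /\ forall v : 'cV[K]_p, 0 <= (v^T *m M *m v) 0 0.

Definition pdmx (K : realType) (p : nat) (M : 'M[K]_p) : Prop :=
  M \is symmetricmx /\
  forall v : 'cV[K]_p, v != 0 -> 0 < (v^T *m M *m v) 0 0.

(* The eigenvalues are the complex ones, taken in K[i]; [normc] is the
   K-valued modulus, whereas the norm `|_| of K[i] is K[i]-valued. *)
Definition spectral_radius (K : realType) (p : nat) (M : 'M[K]_p) : K :=
  sup [set ComplexField.Normc.normc l | l in
        [set l : K[i] | eigenvalue (map_mx (real_complex K) M) l]].

Definition stabilizing (K : realType) (n m : nat)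
    (A : 'M[K]_n) (B : 'M[K]_(n, m)) : set 'M[K]_(m, n) :=
  [set F | spectral_radius (A + B *m F) < 1].

Definition Lambda (K : realType) (n m : nat) (Q : 'M[K]_n) (R : 'M[K]_m) :
    'M[K]_(n + m) :=
  block_mx Q 0 0 R.

Definition augmented (K : realType) (n m : nat)
    (A : 'M[K]_n) (B : 'M[K]_(n, m)) (F : 'M[K]_(m, n)) : 'M[K]_(n + m) :=
  block_mx A B (F *m A) (F *m B).

Definition trajectory (K : realType) (n m : nat)
    (A : 'M[K]_n) (B : 'M[K]_(n, m)) (F : 'M[K]_(m, n)) (z : 'cV[K]_n)
    (k : nat) : 'cV[K]_n :=
  iter k (mulmx (A + B *m F)) z.

Definition stage_cost (K : realType) (n m : nat)
    (A : 'M[K]_n) (B : 'M[K]_(n, m)) (Q : 'M[K]_n) (R : 'M[K]_m) (alpha : K)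
    (F : 'M[K]_(m, n)) (z : 'cV[K]_n) (k : nat) : K :=
  let x := trajectory A B F z k in
  let v := col_mx x (F *m x) in
  alpha ^+ k * (v^T *m Lambda Q R *m v) 0 0.

(* A limit of real partial sums: meaningful only where the series converges. *)
Definition cost (K : realType) (n m : nat)
    (A : 'M[K]_n) (B : 'M[K]_(n, m)) (Q : 'M[K]_n) (R : 'M[K]_m) (alpha : K)
    (F : 'M[K]_(m, n)) (z : 'cV[K]_n) : K :=
  limn (series (stage_cost A B Q R alpha F z)).

(* X is the gradient of f at F: f is Fréchet differentiable at F with
   differential dF |-> Tr(dF^T X). *)
Definition is_gradient (K : realType) (m n : nat)
    (f : 'M[K]_(m, n) -> K) (F X : 'M[K]_(m, n)) : Prop :=
  is_diff F f (fun dF : 'M[K]_(m, n) => \tr (dF^T *m X)).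

Definition is_S (K : realType) (n m : nat)
    (A : 'M[K]_n) (B : 'M[K]_(n, m)) (alpha : K) (F : 'M[K]_(m, n))
    (z : 'cV[K]_n) (S : 'M[K]_(n + m)) : Prop :=
  let AF := augmented A B F in
  let G := col_mx 1%:M F in
  S \is symmetricmx /\
  S = alpha *: (AF *m S *m AF^T) + G *m (z *m z^T) *m G^T.

Definition is_P (K : realType) (n m : nat)
    (A : 'M[K]_n) (B : 'M[K]_(n, m)) (Q : 'M[K]_n) (R : 'M[K]_m) (alpha : K)
    (F : 'M[K]_(m, n)) (P : 'M[K]_(n + m)) : Prop :=
  let AF := augmented A B F in
  P \is symmetricmx /\
  alpha *: (AF^T *m P *m AF) - P + Lambda Q R = 0.

(* Main.v *)
Require Import Defs.
From HB Require Import structures.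
From mathcomp Require Import all_boot all_order all_algebra.
From mathcomp Require Import ring lra complex.
From mathcomp Require Import all_classical all_reals all_analysis.

Set Implicit Arguments.
Unset Strict Implicit.
Unset Printing Implicit Defensive.

Import Order.TTheory GRing.Theory Num.Theory.
Import numFieldNormedType.Exports.

Local Open Scope classical_set_scope.
Local Open Scope ring_scope.

(** Why the gradient formula holds.  Put [M = A + B F], [G = [I; F]] and
    [H = [A B]], so that the augmented matrix is [G H] while [H G = M].  Hence
    its powers are [G M^k H], both equations of the statement are Stein
    equations [X = alpha N X N^T + W] for a matrix [N] whose powers tend to 0,
    and they reduce to the state space: [S = G Sigma G^T] and
    [P = alpha H^T Pi H + Lambda], where [Pi = G^T P G] and
    - [Sigma = alpha M Sigma M^T + z z^T],
    - [Pi = alpha M^T Pi M + Q + F^T R F].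

    The series for the cost is never differentiated term by term.  For a gain
    [F + D], let [Sigma'] be the discounted Gramian
    [sum_k alpha^k x_k x_k^T] of the perturbed trajectory.  Pairing [Pi] with
    the Stein equation of [Sigma'] gives the exact identity
    [J(F + D) = z^T Pi z + 2 tr(D^T E Sigma') + tr(D^T L D Sigma')]
    ([cost_perturb]), where [E = R F + alpha B^T Pi M] and
    [L = R + alpha B^T Pi B].  Replacing [Sigma'] by [Sigma] in the term that
    is linear in [D] costs [O(|D|^2)] as soon as [Sigma' - Sigma] is [O(|D|)],
    and reading [E Sigma] through the blocks of [S] and [P] gives the formula.

    Three facts about the closed loop carry the analysis.
    - [powers_small]: [rho(M) < 1] forces [M^k -> 0].  Over the complex
      numbers Cayley-Hamilton writes 0 as a product of factors [M - l] with
      [|l| < r < 1]; these are removed one at a time, each by solving a scalar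
      recursion [x_(k+1) = l x_k + O(r^k)].
    - [energy_bound]: a quadratic Lyapunov function for [M] still decreases
      along [M + E] for every small [E], so the energies
      [sum_k |x_k|^2] are bounded uniformly near [F].  This gives convergence of
      the perturbed series and a common bound on the [Sigma'].
    - [stein_bound]: [|X| <= c |X - alpha M X M^T|].  It yields unique
      solvability of Stein equations and, applied to [Sigma' - Sigma], the
      Lipschitz estimate ([gramian_lipschitz]). *)

(** * The maximum norm on matrices *)

Section MatrixNorm.
Variable K : realType.

Lemma normmx_entry p q (X : 'M[K]_(p, q)) i j : `|X i j| <= `|X|.
Proof.
rewrite [leRHS]/Num.norm /= mx_normrE.
by apply/bigmax_geP; right; exists (i, j).
Qed.

Lemma normmx_le p q (X : 'M[K]_(p, q)) c :
  0 <= c -> (forall i j, `|X i j| <= c) -> `|X| <= c.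
Proof.
by move=> c0 h; rewrite /Num.norm /= mx_normrE; apply/bigmax_leP; split.
Qed.

Lemma normmx_mul p q r (X : 'M[K]_(p, q)) (Y : 'M[K]_(q, r)) :
  `|X *m Y| <= q%:R * (`|X| * `|Y|).
Proof.
apply: normmx_le => [|i j]; first by rewrite !mulr_ge0.
rewrite mxE (le_trans (ler_norm_sum _ _ _))// mulr_natl.
rewrite -[X in _ <= _ *+ X]card_ord -sumr_const ler_sum// => k _.
by rewrite normrM ler_pM ?normmx_entry.
Qed.

Lemma normmx_tr p q (X : 'M[K]_(p, q)) : `|X^T| = `|X|.
Proof.
apply/le_anti/andP; split; apply: normmx_le => // i j.
  by rewrite mxE normmx_entry.
by have := normmx_entry X^T j i; rewrite mxE.
Qed.

Lemma norm_mxtrace p (X : 'M[K]_p) : `|\tr X| <= p%:R * `|X|.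
Proof.
rewrite (le_trans (ler_norm_sum _ _ _))// mulr_natl.
rewrite -[X in _ <= _ *+ X]card_ord -sumr_const ler_sum// => k _.
exact: normmx_entry.
Qed.

End MatrixNorm.

(** * Powers of a matrix of spectral radius less than one *)

(** The constant [d] is chosen so that [|l| d + c <= d r], which makes the
    bound [d r^k] propagate along the recursion. *)
Lemma scalar_recursion_bound (C : numFieldType) (x : nat -> C) (l r c : C) :
  `|l| < r -> 0 <= c -> (forall k, `|x k.+1 - l * x k| <= c * r ^+ k) ->
  forall k, `|x k| <= (`|x 0%N| + c / (r - `|l|)) * r ^+ k.
Proof.
move=> lr c0 h; set d := _ + _.
have rl : 0 < r - `|l| by rewrite subr_gt0.
have r0 : 0 <= r by rewrite (le_trans _ (ltW lr)).
have dE : `|l| * d + c <= d * r.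
  rewrite -lerBrDl [d * r]mulrC -mulrBl mulrDr mulrCA mulfV ?gt_eqF// mulr1.
  by rewrite lerDr mulr_ge0// ltW.
elim=> [|k IH]; first by rewrite expr0 mulr1 lerDl divr_ge0// ltW.
rewrite -[x k.+1](subrK (l * x k)) (le_trans (ler_normD _ _))//.
rewrite (@le_trans _ _ (c * r ^+ k + `|l| * (d * r ^+ k)))//.
  by rewrite lerD// normrM ler_wpM2l.
by rewrite exprS mulrA mulrA -mulrDl addrC ler_wpM2r// exprn_ge0.
Qed.

(** The last factor [M - l] is absorbed into [X]: the rest of the product
    annihilates [(M - l) X], and each entry [x_k] of [M^k X] satisfies
    [x_(k+1) - l x_k = O(r^k)].  Taking [X] arbitrary rather than the identity
    is what makes the induction on [s] work without diagonalizing [M]. *)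
Lemma annihilated_power_bound (C : numFieldType) n p (M : 'M[C]_n)
    (s : seq C) (r : C) (X : 'M[C]_(n, p)) :
  0 <= r -> (forall l, l \in s -> `|l| < r) ->
  (\prod_(l <- s) (M - l%:M)) *m X = 0 ->
  exists2 c, 0 <= c & forall k i j, `|(M ^+ k *m X) i j| <= c * r ^+ k.
Proof.
move=> r0; elim/last_ind: s X => [|s l IH] X hs.
  rewrite big_nil mul1mx => ->; exists 0 => // k i j.
  by rewrite mulmx0 mxE normr0 mul0r.
rewrite -cats1 big_cat big_seq1 /= -mulmxA => /IH[l' l's|c c0 hc].
  by apply: hs; rewrite mem_rcons inE l's orbT.
have lr : `|l| < r by apply: hs; rewrite mem_rcons inE eqxx.
have rl : 0 <= (r - `|l|)^-1 by rewrite invr_ge0 subr_ge0 ltW.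
have b0 i j : 0 <= `|X i j| + c / (r - `|l|) by rewrite addr_ge0// mulr_ge0.
exists (\sum_i \sum_j (`|X i j| + c / (r - `|l|))).
  by rewrite sumr_ge0// => i _; rewrite sumr_ge0.
move=> k i j.
have H k' : `|(M ^+ k'.+1 *m X) i j - l * (M ^+ k' *m X) i j| <= c * r ^+ k'.
  have -> // : (M ^+ k'.+1 *m X) i j - l * (M ^+ k' *m X) i j =
           (M ^+ k' *m ((M - l%:M) *m X)) i j.
  rewrite mulmxBl mul_scalar_mx mulmxBr -scalemxAr mulmxA exprSr.
  by rewrite !mxE.
apply: (le_trans (scalar_recursion_bound lr c0 H k)).
rewrite expr0 mul1mx ler_wpM2r ?exprn_ge0//.
rewrite (bigD1 i)//= (bigD1 j)//= -addrA lerDl addr_ge0//.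
  by rewrite sumr_ge0.
by rewrite sumr_ge0// => i' _; rewrite sumr_ge0.
Qed.

Section Powers.
Variable K : realType.

(** The existence of arbitrarily small powers, weaker in form than convergence
    to 0, is all that contraction arguments consume. *)
Definition vanishing_powers p (M : 'M[K]_p) :=
  forall e : K, 0 < e -> exists N, `|M ^+ N| < e.

(** The spectrum is the finite set of roots of the characteristic polynomial;
    this gives the upper bound that a supremum needs to be meaningful. *)
Lemma eigenvalue_le_spectral_radius n (M : 'M[K]_n) (l : K[i]) :
  eigenvalue (map_mx (real_complex K) M) l ->
  ComplexField.Normc.normc l <= spectral_radius M.
Proof.
move=> hl; apply: ub_le_sup; last by exists l.
set p := char_poly (map_mx (real_complex K) M).
have [s ps] := closed_field_poly_normal p.
have lp : lead_coef p = 1 by exact/monicP/char_poly_monic.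
exists (\sum_(x <- s) ComplexField.Normc.normc x) => _ [x hx <-].
have {hx} : eigenvalue (map_mx (real_complex K) M) x by [].
rewrite eigenvalue_root_char -/p ps lp scale1r root_prod_XsubC => xs.
rewrite (big_rem x)//= lerDl sumr_ge0// => -[a b] _ /=; exact: sqrtr_ge0.
Qed.

(** Cayley-Hamilton over the complex numbers, with a rate [r] placed strictly
    between the spectral radius and 1. *)
Lemma powers_small n (M : 'M[K]_n) :
  spectral_radius M < 1 -> vanishing_powers M.
Proof.
case: n M => [M _ e e0|n M hM e e0].
  (* the entries of an empty matrix are bounded by 0 *)
  by exists 0%N; rewrite (le_lt_trans _ e0)// normmx_le// => -[].
pose iota := real_complex K; pose MC := map_mx iota M.
have [s ps] := closed_field_poly_normal (char_poly MC).
have lp : lead_coef (char_poly MC) = 1 by exact/monicP/char_poly_monic.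
rewrite lp scale1r in ps.
(* the maximum with 0 spares a proof that the spectral radius is nonnegative *)
pose r : K := Num.max 0 ((spectral_radius M + 1) / 2).
have r0 : 0 <= r by rewrite le_max lexx.
have r1 : r < 1.
  by rewrite gt_max ltr01 ltr_pdivrMr// mul1r [ltRHS]mulr2n ltrD2r.
have hs l : l \in s -> `|l| < iota r.
  move=> ls; have /eigenvalue_le_spectral_radius hl : eigenvalue MC l.
    by rewrite eigenvalue_root_char ps root_prod_XsubC.
  have -> : `|l| = iota (ComplexField.Normc.normc l) by [].
  rewrite ltcR (le_lt_trans hl)// lt_max; apply/orP; right.
  by rewrite ltr_pdivlMr// [ltLHS]mulr_natr mulr2n ltrD2l.
have CH : \prod_(l <- s) (MC - l%:M) *m 1%:M = 0.
  have := Cayley_Hamilton MC; rewrite ps rmorph_prod /= => h.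
  rewrite mulmx1 -[RHS]h; apply: eq_bigr => l _.
  by rewrite rmorphB /= horner_mx_X horner_mx_C.
have rC0 : 0 <= iota r by rewrite lecR.
have [c c0 hc] := annihilated_power_bound rC0 hs CH.
have [c' cE] : exists c', c = iota c'.
  case: c c0 {hc} => a b; rewrite lecE /= => /andP[/eqP b0 _]; exists a.
  by rewrite /iota /= /real_complex_def b0.
have bound k : `|M ^+ k| <= c' * r ^+ k.
  have c'0 : 0 <= c' by rewrite -lecR -/iota -cE.
  apply: normmx_le => [|i j]; first by rewrite mulr_ge0 ?exprn_ge0.
  have := hc k i j; rewrite mulmx1 /MC -rmorphXn /= mxE cE.
  by rewrite normc_def /= expr0n addr0 sqrtr_sqr -rmorphXn -rmorphM lecR.
have : (fun k => c' * r ^+ k) @ \oo --> (0 : K).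
  rewrite -[X in _ --> X](mulr0 c'); apply: cvgM; first exact: cvg_cst.
  by apply: cvg_expr; rewrite ger0_norm.
move=> /cvgrPdist_lt/(_ e e0)[N _ /(_ N (leqnn N))] /=.
rewrite sub0r normrN => h; exists N.
exact: le_lt_trans (le_trans (bound N) (ler_norm _)) h.
Qed.

End Powers.

(** * Stein equations *)

Section Stein.
Variable K : realType.

Lemma trmx_symmetric p (X : 'M[K]_p) : X^T = X <-> X \is symmetricmx.
Proof.
split=> [XT|/is_hermitianmxP].
  by apply/is_hermitianmxP; rewrite expr0 scale1r map_mx_id.
by rewrite expr0 scale1r map_mx_id.
Qed.

Lemma normmx_mul3 p q r s (X : 'M[K]_(p, q)) (Y : 'M[K]_(q, r))
    (Z : 'M[K]_(r, s)) :
  `|X *m Y *m Z| <= q%:R * r%:R * (`|X| * `|Y| * `|Z|).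
Proof.
rewrite (le_trans (normmx_mul _ _))// [leRHS](_ : _ =
  r%:R * (q%:R * (`|X| * `|Y|) * `|Z|)); last by ring.
by rewrite ler_wpM2l// ler_wpM2r// normmx_mul.
Qed.

Lemma trmxX p (M : 'M[K]_p) k : (M ^+ k)^T = M^T ^+ k.
Proof.
elim: k => [|k IH]; first by rewrite !expr0 trmx1.
by rewrite exprSr exprS trmx_mul IH.
Qed.

Lemma vanishing_powers_tr p (M : 'M[K]_p) :
  vanishing_powers M -> vanishing_powers M^T.
Proof. by move=> h e /h[N hN]; exists N; rewrite -trmxX normmx_tr. Qed.

(** Makes the map [X |-> M^N X (M^N)^T] a contraction of ratio 1/2; the factor
    [p * p] is the price of the maximum norm for a triple product. *)
Lemma vanishing_powers_contract p (M : 'M[K]_p) : vanishing_powers M ->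
  exists N, p%:R * p%:R * (`|M ^+ N| * `|M ^+ N|) <= 2^-1.
Proof.
move=> /(_ (2^-1 / p.+1%:R)); rewrite divr_gt0// => /(_ isT)[N hN]; exists N.
have h : p%:R * `|M ^+ N| <= 2^-1.
  rewrite (@le_trans _ _ (p.+1%:R * (2^-1 / p.+1%:R)))//.
    by rewrite ler_pM// ?ler_nat// ltW.
  by rewrite mulrCA divff// mulr1.
rewrite mulrACA (@le_trans _ _ (2^-1 * 2^-1))//.
  by rewrite ler_pM// mulr_ge0.
by rewrite ler_piMr// invf_le1// ler1n.
Qed.

(** Unrolls [X = a M X M^T + E], with [E] the residual, [N] times. *)
Lemma stein_iterate p (M X : 'M[K]_p) a N :
  X = a ^+ N *: (M ^+ N *m X *m (M ^+ N)^T) +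
    \sum_(k < N) a ^+ k *: (M ^+ k *m (X - a *: (M *m X *m M^T)) *m (M ^+ k)^T).
Proof.
elim: N => [|N IH].
  by rewrite big_ord0 !expr0 trmx1 mul1mx mulmx1 scale1r addr0.
have step : a ^+ N *: (M ^+ N *m X *m (M ^+ N)^T) =
    a ^+ N.+1 *: (M ^+ N.+1 *m X *m (M ^+ N.+1)^T) +
    a ^+ N *: (M ^+ N *m (X - a *: (M *m X *m M^T)) *m (M ^+ N)^T).
  rewrite mulmxBr mulmxBl scalerBr -scalemxAr -scalemxAl scalerA -exprSr.
  by rewrite !exprSr trmx_mul !mulmxA addrC subrK.
by rewrite {1}IH big_ord_recr /= step -addrA [X in _ + X = _]addrC.
Qed.

(** After [N] unrollings the remainder is at most [|X| / 2], so that it can be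
    moved to the left-hand side.  The one estimate contains injectivity of the
    Stein operator and Lipschitz dependence of solutions on the data. *)
Lemma stein_bound p (M : 'M[K]_p) (a : K) :
  vanishing_powers M -> 0 <= a <= 1 ->
  exists2 c, 0 <= c & forall X, `|X| <= c * `|X - a *: (M *m X *m M^T)|.
Proof.
move=> /vanishing_powers_contract[N hN] /andP[a0 a1].
pose d := \sum_(k < N) p%:R * p%:R * (`|M ^+ k| * `|M ^+ k|).
have d0 : 0 <= d by rewrite sumr_ge0// => k _; rewrite !mulr_ge0.
have aX k : 0 <= a ^+ k <= 1 by rewrite exprn_ge0//= exprn_ile1.
have conj k Z : `|a ^+ k *: (M ^+ k *m Z *m (M ^+ k)^T)| <=
    p%:R * p%:R * (`|M ^+ k| * `|M ^+ k|) * `|Z|.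
  have /andP[ak0 ak1] := aX k; rewrite normrZ ger0_norm//.
  rewrite (le_trans (ler_piMl (normr_ge0 _) ak1))//.
  rewrite (le_trans (normmx_mul3 _ _ _))// normmx_tr.
  by rewrite -(mulrA (_ * _)) ler_wpM2l ?mulr_ge0// mulrAC.
exists (2 * d) => [|X]; first by rewrite mulr_ge0.
set E := X - _.
have : `|X| <= 2^-1 * `|X| + d * `|E|.
  rewrite {1}(stein_iterate M X a N) (le_trans (ler_normD _ _))// lerD//.
    by rewrite (le_trans (conj _ _))// ler_wpM2r.
  by rewrite (le_trans (ler_norm_sum _ _ _))// mulr_suml ler_sum.
move: `|X| `|E| => x y; lra.
Qed.

(** [stein_bound] makes the linear operator [X |-> X - a M X M^T] injective,
    hence bijective as its domain has finite dimension; the solution inherits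
    the symmetry of [W] because its transpose solves the same equation. *)
Lemma stein_solution p (M W : 'M[K]_p) (a : K) :
  vanishing_powers M -> 0 <= a <= 1 -> W \is symmetricmx ->
  exists X, unique (fun Y => Y \is symmetricmx /\
                             Y = a *: (M *m Y *m M^T) + W) X.
Proof.
move=> hM ha hW; have [c c0 hc] := stein_bound hM ha.
have injS X : X - a *: (M *m X *m M^T) = 0 -> X = 0.
  move=> X0; apply/eqP; rewrite -normr_le0.
  by have := hc X; rewrite X0 normr0 mulr0.
have uniqS X Y : X = a *: (M *m X *m M^T) + W ->
    Y = a *: (M *m Y *m M^T) + W -> X = Y.
  move=> /eqP; rewrite addrC -subr_eq => /eqP hX.
  move=> /eqP; rewrite addrC -subr_eq => /eqP hY.
  apply/subr0_eq/injS.
  by rewrite mulmxBr mulmxBl scalerBr opprD addrACA -opprD hX hY subrr.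
pose f : 'M[K]_p -> 'M[K]_p := idfun \- (a \*: (mulmxr M^T \o mulmx M)).
have fE X : mxvec X *m lin_mx f = mxvec (X - a *: (M *m X *m M^T)).
  exact: mul_vec_lin.
have unitf : lin_mx f \in unitmx.
  rewrite -row_free_unit; apply: inj_row_free => v vA.
  have := fE (vec_mx v); rewrite vec_mxK vA => /esym/eqP.
  by rewrite mxvec_eq0 => /eqP/injS v0; rewrite -[v]vec_mxK v0 linear0.
pose X := vec_mx (mxvec W *m invmx (lin_mx f)).
have XE : X = a *: (M *m X *m M^T) + W.
  apply/eqP; rewrite addrC -subr_eq; apply/eqP/(can_inj mxvecK).
  by rewrite -fE vec_mxK mulmxKV.
exists X; split=> [|Y [_ hY]]; last exact: uniqS.
split=> //; apply/trmx_symmetric/uniqS => //.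
rewrite {1}XE linearD linearZ /= !trmx_mul trmxK mulmxA; congr (_ + _).
exact/trmx_symmetric.
Qed.

End Stein.

(** * Lyapunov functions and uniform energy bounds *)

Section Lyapunov.
Variable K : realType.

Definition quad p (N : 'M[K]_p) (x : 'cV[K]_p) : K := (x^T *m N *m x) 0 0.

Lemma quadD p (X Y : 'M[K]_p) x : quad (X + Y) x = quad X x + quad Y x.
Proof. by rewrite /quad mulmxDr mulmxDl mxE. Qed.

Lemma quadZ p a (X : 'M[K]_p) x : quad (a *: X) x = a * quad X x.
Proof. by rewrite /quad -scalemxAr -scalemxAl mxE. Qed.

Lemma quadN p (X : 'M[K]_p) x : quad (- X) x = - quad X x.
Proof. by rewrite -scaleN1r quadZ mulN1r. Qed.

Lemma quad_congr p q (X : 'M[K]_p) (M : 'M[K]_(p, q)) x :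
  quad X (M *m x) = quad (M^T *m X *m M) x.
Proof. by rewrite /quad trmx_mul !mulmxA. Qed.

Lemma quad1_mul p q (M : 'M[K]_(p, q)) x :
  quad 1%:M (M *m x) = quad (M^T *m M) x.
Proof. by rewrite quad_congr mulmx1. Qed.

Lemma quadE p (X : 'M[K]_p) x :
  quad X x = \sum_j \sum_i X i j * (x i 0 * x j 0).
Proof.
rewrite /quad mxE; apply: eq_bigr => j _; rewrite mxE mulr_suml.
by apply: eq_bigr => i _; rewrite !mxE; ring.
Qed.

Lemma quad1E p (x : 'cV[K]_p) : quad 1%:M x = \sum_i x i 0 ^+ 2.
Proof.
rewrite /quad mulmx1 mxE; apply: eq_bigr => i _; by rewrite mxE expr2.
Qed.

Lemma quad1_ge0 p (x : 'cV[K]_p) : 0 <= quad 1%:M x.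
Proof. by rewrite quad1E sumr_ge0// => i _; rewrite sqr_ge0. Qed.

Lemma norm_quad p (X : 'M[K]_p) x : `|quad X x| <= p%:R * `|X| * quad 1%:M x.
Proof.
have pp (u v : K) : `|u * v| <= (u ^+ 2 + v ^+ 2) / 2.
  rewrite ler_norml; have := sqr_ge0 (u + v); have := sqr_ge0 (u - v); nra.
rewrite quadE (@le_trans _ _
   (\sum_j \sum_i `|X| * ((x i 0 ^+ 2 + x j 0 ^+ 2) / 2)))//.
  rewrite (le_trans (ler_norm_sum _ _ _))// ler_sum// => j _.
  rewrite (le_trans (ler_norm_sum _ _ _))// ler_sum// => i _.
  by rewrite normrM ler_pM// normmx_entry.
rewrite (eq_bigr (fun j => `|X| / 2 * (quad 1%:M x + p%:R * x j 0 ^+ 2))).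
  rewrite -mulr_sumr big_split /= sumr_const card_ord -mulr_sumr -quad1E.
  rewrite -[_ *+ p]mulr_natl le_eqVlt; apply/orP; left; apply/eqP; by field.
move=> j _; rewrite -mulr_sumr -mulrA; congr (_ * _).
rewrite -mulr_suml big_split /= -quad1E sumr_const card_ord.
by rewrite mulrC -[_ *+ p]mulr_natl.
Qed.

(** A finite sum [Y = sum_(k < N) (M^k)^T M^k] suffices: [Y - M^T Y M]
    telescopes to [1 - (M^N)^T M^N], and [M^N] is small. *)
Lemma lyapunov p (M : 'M[K]_p) : vanishing_powers M ->
  exists Y : 'M[K]_p, (forall x, 0 <= quad Y x) /\
    forall x, quad Y (M *m x) + 2^-1 * quad 1%:M x <= quad Y x.
Proof.
move=> /vanishing_powers_contract[N hN].
exists (\sum_(k < N) (M ^+ k)^T *m M ^+ k); split=> x.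
  elim: N {hN} => [|N IH].
    by rewrite big_ord0 /quad mulmx0 mul0mx mxE.
  rewrite big_ord_recr quadD addr_ge0//.
  by rewrite -quad1_mul quad1_ge0.
have tele k : quad (\sum_(i < k) (M ^+ i)^T *m M ^+ i) (M *m x) + quad 1%:M x =
    quad (\sum_(i < k) (M ^+ i)^T *m M ^+ i) x + quad 1%:M (M ^+ k *m x).
  elim: k => [|k IH].
    by rewrite !big_ord0 /quad !mulmx0 !mul0mx !mxE expr0 mul1mx.
  rewrite !big_ord_recr /= !quadD addrAC IH -!quad1_mul.
  by rewrite exprSr -mulmxA addrAC.
have : quad 1%:M (M ^+ N *m x) <= 2^-1 * quad 1%:M x.
  rewrite quad1_mul (le_trans (ler_norm _))//.
  rewrite (le_trans (norm_quad _ _))// ler_wpM2r ?quad1_ge0//.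
  rewrite (le_trans _ hN)// -mulrA ler_wpM2l// -(normmx_tr (M ^+ N)) .
  by rewrite (le_trans (normmx_mul _ _))// normmx_tr.
have := tele N; lra.
Qed.

Lemma congr_perturb p (M E X : 'M[K]_p) : `|E| <= 1 ->
  `|(M + E) *m X *m (M + E)^T - M *m X *m M^T| <=
     p%:R * p%:R * (2 * `|M| + 1) * `|X| * `|E|.
Proof.
move=> E1.
have -> : (M + E) *m X *m (M + E)^T - M *m X *m M^T =
    M *m X *m E^T + E *m X *m M^T + E *m X *m E^T.
  rewrite linearD /= !mulmxDl !mulmxDr.
  by rewrite -[X in X - _]addrA addrAC subrr add0r addrA.
apply: le_trans (ler_normD _ _) _.
apply: le_trans (lerD (ler_normD _ _) (lexx _)) _.
have h (U V : 'M[K]_p) : `|U *m X *m V^T| <= p%:R * p%:R * (`|U| * `|X| * `|V|).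
  by rewrite (le_trans (normmx_mul3 _ _ _))// normmx_tr.
rewrite (le_trans (lerD (lerD (h _ _) (h _ _)) (h _ _)))//.
rewrite -!mulrDr -!(mulrA (p%:R * _)).
rewrite ler_wpM2l//.
have : `|E| * `|X| * `|E| <= 1 * `|X| * `|E|.
  by rewrite ler_wpM2r// ler_wpM2r.
lra.
Qed.

(** The decrease of [quad Y] by half the energy along [M] leaves room for a
    quarter along [M + E]; summing the decrements bounds the energy of the
    whole trajectory by [4 * quad Y z], whatever the small [E]. *)
Lemma energy_bound p (M : 'M[K]_p) (z : 'cV[K]_p) : vanishing_powers M ->
  exists2 b, 0 <= b & exists2 d, 0 < d & forall E, `|E| <= d ->
    forall N, \sum_(k < N) quad 1%:M (iter k (mulmx (M + E)) z) <= b.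
Proof.
move=> /lyapunov[Y [Y0 YM]].
pose c := p%:R * (p%:R * p%:R * (2 * `|M| + 1) * `|Y|).
have c0 : 0 <= c by rewrite !mulr_ge0// addr_ge0// mulr_ge0.
exists (4 * quad Y z); first by rewrite mulr_ge0.
have d0 : 0 < (4 * (c + 1))^-1 by rewrite invr_gt0; lra.
have d1 : (4 * (c + 1))^-1 <= 1 by rewrite invf_le1; lra.
exists (4 * (c + 1))^-1 => // E Ed.
have step x : quad Y ((M + E) *m x) + 4^-1 * quad 1%:M x <= quad Y x.
  have /(congr_perturb M^T Y) : `|E^T| <= 1.
    by rewrite normmx_tr (le_trans Ed).
  rewrite -linearD /= !trmxK !normmx_tr => hE.
  have : quad Y ((M + E) *m x) - quad Y (M *m x) <= 4^-1 * quad 1%:M x.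
    rewrite 2!quad_congr -quadN -quadD (le_trans (ler_norm _))//.
    rewrite (le_trans (norm_quad _ _))// ler_wpM2r ?quad1_ge0//.
    rewrite (le_trans (ler_wpM2l _ hE))// mulrA -/c.
    rewrite (le_trans (ler_wpM2l c0 Ed))// ler_pdivrMr; lra.
  have := YM x; lra.
move=> N.
suff : \sum_(k < N) quad 1%:M (iter k (mulmx (M + E)) z) +
    4 * quad Y (iter N (mulmx (M + E)) z) <= 4 * quad Y z.
  by apply: le_trans; rewrite lerDl mulr_ge0.
elim: N => [|N IH]; first by rewrite big_ord0 add0r.
rewrite big_ord_recr /=; have := step (iter N (mulmx (M + E)) z).
move: IH; lra.
Qed.

End Lyapunov.

(** * The discounted Gramian of a trajectory *)

Section Gramian.
Variable K : realType.

Lemma mxtrace_mulE p (X Y : 'M[K]_p) :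
  \tr (X *m Y) = \sum_j \sum_i X i j * Y j i.
Proof. by rewrite exchange_big /=; apply: eq_bigr => i _; rewrite mxE. Qed.

(** The trace pairing is nondegenerate: a matrix equation may be checked after
    pairing it with every matrix, where it becomes a statement on series. *)
Lemma mxtrace_inj p (X Y : 'M[K]_p) :
  (forall N : 'M[K]_p, \tr (N *m X) = \tr (N *m Y)) -> X = Y.
Proof.
have trd (Z : 'M[K]_p) i j : \tr (delta_mx j i *m Z) = Z i j.
  rewrite mxtrace_mulE (bigD1 i)//= (bigD1 j)//= mxE !eqxx mul1r.
  rewrite [X in _ + X + _]big1 ?addr0; last first.
    by move=> k kj; rewrite mxE (negbTE kj) mul0r.
  rewrite [X in _ + X]big1 ?addr0// => k ki; rewrite big1// => l _.
  by rewrite mxE (negbTE ki) andbF mul0r.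
by move=> h; apply/matrixP => i j; rewrite -!trd.
Qed.

Lemma quad_mxtrace p (X : 'M[K]_p) (z : 'cV[K]_p) :
  quad X z = \tr (X *m (z *m z^T)).
Proof. by rewrite mulmxA mxtrace_mulC mulmxA /quad /mxtrace big_ord1. Qed.

(** [G] is [sum_k a^k x_k x_k^T].  Entrywise absolute convergence comes from
    [|x_i x_j| <= |x|^2], and every quadratic cost along the trajectory is the
    pairing of its weight with [G].  The Stein equation is the shift of the
    series by one index, read through the trace pairing. *)
Lemma gramian p (M : 'M[K]_p) (z : 'cV[K]_p) (a b : K) :
  0 <= a <= 1 ->
  (forall N, \sum_(k < N) quad 1%:M (iter k (mulmx M) z) <= b) ->
  exists G : 'M[K]_p, [/\ G^T = G, `|G| <= b,
    G = a *: (M *m G *m M^T) + z *m z^T &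
    forall N, series (fun k => a ^+ k * quad N (iter k (mulmx M) z)) @ \oo
                --> \tr (N *m G)].
Proof.
move=> /andP[a0 a1] hb; pose x k := iter k (mulmx M) z.
pose u i j k := a ^+ k * (x k i 0 * x k j 0).
have b0 : 0 <= b by have := hb 0%N; rewrite big_ord0.
have u_le i j k : `|u i j k| <= quad 1%:M (x k).
  have pp (v w : K) : `|v * w| <= v ^+ 2 + w ^+ 2.
    rewrite ler_norml; have := sqr_ge0 (v + w); have := sqr_ge0 (v - w).
    have := sqr_ge0 v; have := sqr_ge0 w; nra.
  have ak : `|a ^+ k| <= 1 by rewrite ger0_norm ?exprn_ge0// exprn_ile1.
  rewrite normrM (le_trans (ler_piMl _ ak))// quad1E.
  have [<-|ij] := eqVneq i j.
    rewrite normrM -expr2 real_normK ?num_real// (bigD1 i)//= lerDl sumr_ge0//.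
    by move=> l _; rewrite sqr_ge0.
  rewrite (le_trans (pp _ _))// (bigD1 i)//= (bigD1 j) 1?eq_sym//= addrA lerDl.
  by rewrite sumr_ge0// => l _; rewrite sqr_ge0.
have sum_u i j n : \sum_(0 <= k < n) `|u i j k| <= b.
  by rewrite big_mkord (le_trans _ (hb n))// ler_sum.
have cvg_u i j : cvgn (series (u i j)).
  apply: normed_cvg; apply: nondecreasing_is_cvgn.
    by apply: nondecreasing_series => k _ _; exact: normr_ge0.
  by exists b => _ [n _ <-]; exact: sum_u.
pose G : 'M[K]_p := \matrix_(i, j) limn (series (u i j)).
have GT : G^T = G.
  apply/matrixP => i j; rewrite !mxE; congr (limn (series _)).
  by apply/funext => k; rewrite /u (mulrC (x k j 0)).
have cvgG N : series (fun k => a ^+ k * quad N (x k)) @ \oo --> \tr (N *m G).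
  rewrite -GT mxtrace_mulE.
  have -> : series (fun k => a ^+ k * quad N (x k)) =
      (fun n => \sum_j \sum_i N i j * series (u i j) n).
    apply/funext => n; rewrite /series /=.
    under [RHS]eq_bigr do (under eq_bigr do rewrite mulr_sumr;
                           rewrite exchange_big).
    rewrite [RHS]exchange_big; apply: eq_bigr => k _; rewrite quadE mulr_sumr.
    apply: eq_bigr => j _; rewrite mulr_sumr; apply: eq_bigr => i _.
    by rewrite /u; ring.
  apply: cvg_big => [|j _]; first exact: add_continuous.
  apply: cvg_big => [|i _]; first exact: add_continuous.
  by rewrite 2!mxE; apply: cvgM; [exact: cvg_cst|exact: cvg_u].
exists G; split => //.
  apply: normmx_le => // i j; rewrite mxE ler_norml.
  have sle n : `|series (u i j) n| <= b.
    by rewrite /series /= (le_trans (ler_norm_sum _ _ _)).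
  apply/andP; split; [apply: limr_ge|apply: limr_le] => //; apply: nearW => n;
  by have := sle n; rewrite ler_norml => /andP[].
apply: mxtrace_inj => N.
have hN : (fun n => series (fun k => a ^+ k * quad N (x k)) n.+1) @ \oo
    --> \tr (N *m G) by have := cvgG N; rewrite -cvg_shiftS.
apply: (cvg_unique _ hN) => //=.
rewrite (_ : (fun n => _) =
   (fun n => a * series (fun k => a ^+ k * quad (M^T *m N *m M) (x k)) n
             + quad N z)); last first.
  apply/funext => n; rewrite /series /= big_nat_recl// expr0 mul1r addrC.
  congr (_ + _); rewrite mulr_sumr; apply: eq_bigr => k _.
  by rewrite /x /= quad_congr exprS mulrA.
rewrite mulmxDr linearD /= -quad_mxtrace -scalemxAr linearZ /=.
apply: cvgD; last exact: cvg_cst.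
apply: cvgM; first exact: cvg_cst.
have -> : \tr (N *m (M *m G *m M^T)) = \tr (M^T *m N *m M *m G).
  by rewrite mulmxA mxtrace_mulC !mulmxA.
exact: cvgG.
Qed.

End Gramian.


(** * The closed loop and its augmented form *)

Section ClosedLoop.
Variables (K : realType) (n m : nat) (A : 'M[K]_n) (B : 'M[K]_(n, m)).
Variables (Q : 'M[K]_n) (R : 'M[K]_m) (alpha : K).
Implicit Types (F D : 'M[K]_(m, n)) (z : 'cV[K]_n).

Definition closed_loop_weight F : 'M[K]_n := Q + F^T *m R *m F.

Lemma Lambda_congr F :
  (col_mx 1%:M F)^T *m Lambda Q R *m col_mx 1%:M F = closed_loop_weight F.
Proof.
rewrite tr_col_mx trmx1 mul_row_block !mulmx0 addr0 add0r mul1mx.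
by rewrite mul_row_col mulmx1.
Qed.

Lemma stage_cost_quad F z k : stage_cost A B Q R alpha F z k =
  alpha ^+ k * quad (closed_loop_weight F) (iter k (mulmx (A + B *m F)) z).
Proof.
rewrite /stage_cost /trajectory; set x := iter _ _ _.
rewrite -[x in col_mx x]mul1mx -mul_col_mx -Lambda_congr -quad_congr.
by rewrite /quad.
Qed.

Lemma augmentedE F : augmented A B F = col_mx 1%:M F *m row_mx A B.
Proof. by rewrite mul_col_row !mul1mx. Qed.

Lemma row_col_closed F : row_mx A B *m col_mx 1%:M F = A + B *m F.
Proof. by rewrite mul_row_col mulmx1. Qed.

(** From [augmented A B F = G H] and [H G = A + B F]: the power of exponent
    [k + 1] is [G (A + B F)^k H]. *)
Lemma vanishing_powers_augmented F : vanishing_powers (A + B *m F) ->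
  vanishing_powers (augmented A B F).
Proof.
move=> hM e e0; pose G := col_mx 1%:M F; pose H := row_mx A B.
have powE k : augmented A B F ^+ k.+1 = G *m (A + B *m F) ^+ k *m H.
  elim: k => [|k IH]; first by rewrite expr1 expr0 mulmx1 augmentedE.
  rewrite exprSr IH augmentedE -row_col_closed exprSr.
  rewrite -[_ * (row_mx A B *m _)]/(_ *m _).
  by rewrite -[_ * (col_mx _ _ *m _)]/(_ *m _) !mulmxA.
pose c := n%:R * n%:R * (`|G| * `|H|).
have c0 : 0 <= c by rewrite !mulr_ge0.
have [k hk] := hM (e / (c + 1)) (divr_gt0 e0 (ltr_wpDl c0 ltr01)).
exists k.+1; rewrite powE (le_lt_trans (normmx_mul3 _ _ _))//.
rewrite [ltLHS](_ : _ = c * `|(A + B *m F) ^+ k|); last by rewrite /c; ring.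
rewrite (@le_lt_trans _ _ (c * (e / (c + 1))))//.
  by rewrite ler_wpM2l// ltW.
by rewrite mulrCA gtr_pMr// ltr_pdivrMr ?mul1r ?ltrDl// ltr_wpDl.
Qed.

(** Second-order expansion in [D], exact because both quadratic forms involved
    are polynomials of degree two in the gain; symmetry of [R], [P] and [G]
    merges the two cross terms. *)
Lemma weight_perturb F D (P G : 'M[K]_n) :
  R^T = R -> P^T = P -> G^T = G ->
  \tr ((closed_loop_weight (F + D)
        + alpha *: ((A + B *m (F + D))^T *m P *m (A + B *m (F + D)))) *m G) =
  \tr ((closed_loop_weight F
        + alpha *: ((A + B *m F)^T *m P *m (A + B *m F))) *m G)
  + 2 * \tr (D^T *m (R *m F + alpha *: (B^T *m P *m (A + B *m F))) *m G)
  + \tr (D^T *m (R + alpha *: (B^T *m P *m B)) *m D *m G).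
Proof.
move=> RT PT GT.
have expand p (X : 'M[K]_p) (Y Z : 'M[K]_(p, n)) : X^T = X ->
    \tr ((Y + Z)^T *m X *m (Y + Z) *m G) =
    \tr (Y^T *m X *m Y *m G) + 2 * \tr (Z^T *m X *m Y *m G)
    + \tr (Z^T *m X *m Z *m G).
  move=> XT; rewrite [(Y + Z)^T]linearD /= !mulmxDl mulmxDr mulmxDl mulmxDr.
  rewrite !mulmxDl !mxtraceD.
  have -> : \tr (Y^T *m X *m Z *m G) = \tr (Z^T *m X *m Y *m G).
    by rewrite -mxtrace_tr !trmx_mul trmxK XT GT mxtrace_mulC !mulmxA.
  by ring.
have -> : A + B *m (F + D) = A + B *m F + B *m D by rewrite mulmxDr addrA.
move: (A + B *m F) => M; rewrite /closed_loop_weight.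
rewrite !mulmxDl -!scalemxAl !mxtraceD !mxtraceZ.
rewrite (expand _ R F D RT) (expand _ P M (B *m D) PT) trmx_mul.
rewrite !mulmxDr !mulmxDl !mxtraceD -!scalemxAr -!scalemxAl !mxtraceZ !mulmxA.
by ring.
Qed.

End ClosedLoop.

(** * Perturbation of the cost *)

Lemma is_diff_quadratic (K : realType) (V : normedModType K)
    (f : V -> K) (x : V) (df : {linear V -> K}) (c d : K) :
  0 <= c -> 0 < d -> continuous df ->
  (forall h, `|h| <= d -> `|f (x + h) - f x - df h| <= c * `|h| ^+ 2) ->
  is_diff x f df.
Proof.
move=> c0 d0 dfc hc.
have E : f \o shift x = cst (f x) + df +o_ 0 id.
  apply/eqaddoP => e e0; near=> h.
  rewrite /= !fctE /= opprD addrA (addrC h).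
  have hd : `|h| <= d.
    by near: h; apply/nbhs_norm0P; exists d => //= y /= /ltW.
  rewrite (le_trans (hc _ hd))//.
  have he : `|h| <= e / (c + 1).
    near: h; apply/nbhs_norm0P.
    by exists (e / (c + 1)) => /= [|y /= /ltW//]; rewrite divr_gt0// ltr_wpDl.
  rewrite expr2 mulrA ler_wpM2r//.
  rewrite (@le_trans _ _ (c * (e / (c + 1))))//.
    by rewrite ler_wpM2l.
  by rewrite mulrCA ler_piMr ?(ltW e0)// ler_pdivrMr ?mul1r ?lerDl// ltr_wpDl.
have dE := diff_unique dfc E.
split => //; apply/diff_locallyP; rewrite dE; split => //.
Unshelve. all: by end_near. Qed.

Section Gradient.
Variables (K : realType) (n m : nat) (A : 'M[K]_n) (B : 'M[K]_(n, m)).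
Variables (Q : 'M[K]_n) (R : 'M[K]_m) (alpha : K).
Hypothesis alpha01 : 0 <= alpha <= 1.

(** The cost enters through the limit of its series, so that one hypothesis
    carries both convergence and value. *)
Definition is_gramian (F : 'M[K]_(m, n)) (z : 'cV[K]_n) (G : 'M[K]_n) :=
  [/\ G^T = G,
    G = alpha *: ((A + B *m F) *m G *m (A + B *m F)^T) + z *m z^T &
    series (stage_cost A B Q R alpha F z) @ \oo -->
      \tr (closed_loop_weight Q R F *m G)].

(** The closed loop of [F + D] is [A + B F] perturbed by [B D], so that
    [energy_bound] makes [b] independent of [D].  The bound on [B D] is the
    one that [congr_perturb] asks for. *)
Lemma gramian_near (F : 'M[K]_(m, n)) (z : 'cV[K]_n) :
  vanishing_powers (A + B *m F) ->
  exists2 b, 0 <= b & exists2 d, 0 < d & forall D, `|D| <= d ->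
    `|B *m D| <= 1 /\ exists2 G, is_gramian (F + D) z G & `|G| <= b.
Proof.
move=> /(energy_bound z)[b b0 [e e0 hb]]; exists b => //.
pose c := m%:R * `|B|; have c0 : 0 <= c by rewrite mulr_ge0.
pose e' := Num.min e 1.
have e'0 : 0 < e' by rewrite lt_min e0 ltr01.
exists (e' / (c + 1)); first by rewrite divr_gt0// ltr_wpDl.
move=> D hD.
have BD : `|B *m D| <= e'.
  rewrite (le_trans (normmx_mul _ _))// mulrA (le_trans (ler_wpM2l c0 hD))//.
  by rewrite mulrCA ler_piMr ?(ltW e'0)// ler_pdivrMr ?mul1r ?lerDl// ltr_wpDl.
move: BD; rewrite le_min => /andP[/hb BD BD1]; split=> //.
have [|G [GT Gb GE hG]] := @gramian _ _ (A + B *m (F + D)) z alpha b alpha01.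
  by rewrite mulmxDr addrA.
exists G => //; split=> //.
rewrite (_ : stage_cost _ _ _ _ _ _ _ = fun k => alpha ^+ k *
  quad (closed_loop_weight Q R (F + D))
    (iter k (mulmx (A + B *m (F + D))) z)) //.
by apply/funext => k; rewrite stage_cost_quad.
Qed.

(** Pairing [P] with the Stein equation of [G] gives
    [z^T P z = tr((P - alpha M'^T P M') G)] for the perturbed closed loop [M'];
    [weight_perturb] then compares this with [tr(W' G)], the cost. *)
Lemma cost_perturb (F D : 'M[K]_(m, n)) z (P G : 'M[K]_n) :
  R^T = R -> P^T = P ->
  P = alpha *: ((A + B *m F)^T *m P *m (A + B *m F))
      + closed_loop_weight Q R F ->
  is_gramian (F + D) z G ->
  cost A B Q R alpha (F + D) z = quad P z
  + 2 * \tr (D^T *m (R *m F + alpha *: (B^T *m P *m (A + B *m F))) *m G)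
  + \tr (D^T *m (R + alpha *: (B^T *m P *m B)) *m D *m G).
Proof.
move=> RT PT PE [GT GE hG].
have -> : cost A B Q R alpha (F + D) z =
    \tr (closed_loop_weight Q R (F + D) *m G).
  exact: cvg_lim hG.
have := weight_perturb A B Q alpha F D RT PT GT.
rewrite (addrC (closed_loop_weight Q R F)) -PE => h.
have -> : quad P z = \tr (P *m G) - alpha *
    \tr ((A + B *m (F + D))^T *m P *m (A + B *m (F + D)) *m G).
  rewrite {1}GE mulmxDr mxtraceD -scalemxAr mxtraceZ -quad_mxtrace.
  rewrite [X in alpha * X](_ : _ =
    \tr ((A + B *m (F + D))^T *m P *m (A + B *m (F + D)) *m G)).
    by rewrite addrAC subrr add0r.
  by rewrite mulmxA mxtrace_mulC !mulmxA.
move: h; rewrite mulmxDl mxtraceD -scalemxAl mxtraceZ; lra.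
Qed.

(** [G - G0] solves the unperturbed Stein equation with right-hand side
    [alpha (M' G M'^T - M G M^T)], which is [O(|D|)] since [|G| <= b]. *)
Lemma gramian_lipschitz (F : 'M[K]_(m, n)) z G0 b :
  vanishing_powers (A + B *m F) ->
  G0 = alpha *: ((A + B *m F) *m G0 *m (A + B *m F)^T) + z *m z^T -> 0 <= b ->
  exists2 c, 0 <= c & forall D G, `|B *m D| <= 1 -> is_gramian (F + D) z G ->
    `|G| <= b -> `|G - G0| <= c * `|D|.
Proof.
move=> /(stein_bound)/(_ alpha01)[c c0 hc] G0E b0.
set M := A + B *m F in hc G0E *.
pose c1 := n%:R * n%:R * (2 * `|M| + 1).
have c10 : 0 <= c1 by rewrite !mulr_ge0// addr_ge0// mulr_ge0.
exists (c * (c1 * b * (m%:R * `|B|))); first by rewrite !mulr_ge0.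
move=> D G BD [_ GE _] Gb; rewrite mulmxDr addrA -/M in GE.
apply: le_trans (hc _) _.
have -> : G - G0 - alpha *: (M *m (G - G0) *m M^T) =
   alpha *: ((M + B *m D) *m G *m (M + B *m D)^T - M *m G *m M^T).
  have GG0 : G - G0 = alpha *: ((M + B *m D) *m G *m (M + B *m D)^T)
      - alpha *: (M *m G0 *m M^T).
    by rewrite {1}GE {1}G0E opprD addrACA subrr addr0.
  by rewrite mulmxBr mulmxBl !scalerBr {}GG0 opprB addrA subrK.
rewrite -!mulrA ler_wpM2l// normrZ ger0_norm; last by case/andP: alpha01.
have /andP[a0 a1] := alpha01.
rewrite (le_trans (ler_piMl (normr_ge0 _) a1))//.
rewrite (le_trans (congr_perturb M G BD))// -/c1 !mulrA -(mulrA (c1 * _)).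
rewrite -(mulrA (c1 * b)) ler_pM ?mulr_ge0// ?ler_wpM2l//.
by rewrite (le_trans (normmx_mul _ _))// mulrA.
Qed.

Lemma continuous_mxtrace_pairing (p q : nat) (X : 'M[K]_(p, q)) :
  continuous (fun D : 'M[K]_(p, q) => \tr (D^T *m X)).
Proof.
have trE (U : 'M[K]_(p, q)) : \tr (U^T *m X) = \sum_i \sum_j U j i * X j i.
  by apply: eq_bigr => i _; rewrite mxE; apply: eq_bigr => j _; rewrite mxE.
rewrite (funext trE) => D.
apply: cvg_big => [||i _]; [exact: add_continuous|exact: nbhs_filter|].
apply: cvg_big => [||j _]; [exact: add_continuous|exact: nbhs_filter|].
by apply: cvgM; [exact: nbhs_filter|exact: coord_continuous|
  apply: (@cvg_cst _ _ _ _ (nbhs_filter D))].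
Qed.

(** The gradient in state-space form; [k1] bounds the error of replacing the
    Gramian of [F + D] by [G0] in the linear term, and [k2] the quadratic
    term. *)
Lemma cost_gradient (F : 'M[K]_(m, n)) z (P G0 : 'M[K]_n) :
  R^T = R -> vanishing_powers (A + B *m F) ->
  P^T = P ->
  P = alpha *: ((A + B *m F)^T *m P *m (A + B *m F))
      + closed_loop_weight Q R F ->
  G0 = alpha *: ((A + B *m F) *m G0 *m (A + B *m F)^T) + z *m z^T ->
  is_gradient (fun F' => cost A B Q R alpha F' z) F
   (2 *: ((R *m F + alpha *: (B^T *m P *m (A + B *m F))) *m G0)).
Proof.
move=> RT hM PT PE G0E; have [b b0 [d d0 hd]] := gramian_near z hM.
have [c c0 hc] := gramian_lipschitz hM G0E b0.
set E := R *m F + _; set X := 2 *: _.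
pose H := R + alpha *: (B^T *m P *m B).
have lin : linear (fun D : 'M[K]_(m, n) => \tr (D^T *m X)).
  move=> a U V; rewrite [(_ + _)^T]linearP /= mulmxDl -scalemxAl.
  by rewrite mxtraceD mxtraceZ.
pose df : {linear 'M[K]_(m, n) -> K} :=
  HB.pack (fun D : 'M[K]_(m, n) => \tr (D^T *m X))
    (GRing.isLinear.Build _ _ _ _ _ lin).
have dfc : continuous df by exact: continuous_mxtrace_pairing.
pose k1 := 2 * (n%:R * (m%:R * n%:R * `|E| * c)).
pose k2 := n%:R * (m%:R * m%:R * `|H| * (n%:R * b)).
have k0 : 0 <= k1 + k2 by rewrite addr_ge0// !mulr_ge0.
apply: (@is_diff_quadratic _ _ _ _ df (k1 + k2) d) => // D hD.
have [BD [G hG Gb]] := hd D hD.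
rewrite (cost_perturb RT PT PE hG) -/E -/H.
have [_ [G1 hG1 _]] : `|B *m (0 : 'M[K]_(m, n))| <= 1 /\
    exists2 G, is_gramian (F + 0) z G & `|G| <= b.
  by apply: hd; rewrite normr0 ltW.
(* the same identity at D = 0 evaluates the unperturbed cost *)
have := cost_perturb RT PT PE hG1; rewrite addr0 trmx0 !mul0mx mxtrace0.
rewrite mulr0 !addr0 => ->.
have -> : df D = 2 * \tr (D^T *m E *m G0).
  by rewrite /df /= /X -scalemxAr mxtraceZ mulmxA.
have -> : forall p u v w : K, p + 2 * u + v - p - 2 * w = 2 * (u - w) + v.
  by move=> *; ring.
rewrite -linearB /= -mulmxBr.
rewrite (le_trans (ler_normD _ _))// [leRHS]mulrDl lerD//.
  rewrite normrM ger0_norm// /k1 -!mulrA ler_wpM2l//.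
  rewrite (le_trans (norm_mxtrace _))// ler_wpM2l//.
  rewrite (le_trans (normmx_mul3 _ _ _))// normmx_tr -!mulrA !ler_wpM2l//.
  rewrite expr2 [leRHS](_ : _ = `|D| * (`|E| * (c * `|D|))); last by ring.
  by rewrite !ler_wpM2l// hc.
rewrite (le_trans (norm_mxtrace _))// /k2 -!mulrA ler_wpM2l//.
rewrite -[_ *m D *m G]mulmxA.
rewrite (le_trans (normmx_mul3 _ _ _))// normmx_tr -!mulrA !ler_wpM2l//.
rewrite [leRHS](_ : _ = `|D| * (`|H| * (n%:R * (`|D| * b)))); last by ring.
rewrite !ler_wpM2l// (le_trans (normmx_mul _ _))//.
by rewrite ler_wpM2l// ler_wpM2l.
Qed.

End Gradient.

(** * The gradient formula *)
Theorem proposition1 (K : realType) (n m : nat)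
    (A : 'M[K]_n) (B : 'M[K]_(n, m)) (Q : 'M[K]_n) (R : 'M[K]_m) (alpha : K)
    (hQ : psdmx Q) (hR : pdmx R) (halpha : 0 < alpha <= 1)
    (F : 'M[K]_(m, n)) (hF : stabilizing A B F) (z : 'cV[K]_n) :
  (\forall F' \near F, cvgn (series (stage_cost A B Q R alpha F' z))) /\
  exists S P : 'M[K]_(n + m),
    [/\ unique (is_S A B alpha F z) S,
        unique (is_P A B Q R alpha F) P &
        is_gradient (fun F' => cost A B Q R alpha F' z) F
          (2%:R *: ((ursubmx P)^T *m ulsubmx S)
           + 2%:R *: (drsubmx P *m (ursubmx S)^T))].
Proof.
have alpha01 : 0 <= alpha <= 1.
  by have /andP[a0 ->] := halpha; rewrite ltW.
have hM : vanishing_powers (A + B *m F) := powers_small hF.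
have QT : Q^T = Q by apply/trmx_symmetric; case: hQ.
have RT : R^T = R by apply/trmx_symmetric; case: hR.
split.
  have [b _ [d d0 hd]] := gramian_near Q R alpha01 z hM.
  apply/nbhs_normP; exists d => //= F' /ltW; rewrite distrC.
  move=> /hd[_ [G [_ _ hG] _]]; rewrite addrC subrK in hG.
  by apply/cvg_ex; exists (\tr (closed_loop_weight Q R F' *m G)).
pose G := col_mx 1%:M F; pose H := row_mx A B.
have HG : H *m G = A + B *m F := row_col_closed A B F.
have hAF := vanishing_powers_augmented hM.
have WT : (G *m (z *m z^T) *m G^T)^T = G *m (z *m z^T) *m G^T.
  by rewrite !trmx_mul !trmxK !mulmxA.
have LT : (Lambda Q R)^T = Lambda Q R.
  by rewrite tr_block_mx !trmx0 QT RT.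
have [S hS] := stein_solution hAF alpha01 (iffLR (trmx_symmetric _) WT).
have [P hP] := stein_solution (vanishing_powers_tr hAF) alpha01
  (iffLR (trmx_symmetric _) LT).
have isPE X : is_P A B Q R alpha F X <-> X \is symmetricmx /\
    X = alpha *: ((augmented A B F)^T *m X *m (augmented A B F)^T^T)
        + Lambda Q R.
  rewrite /is_P /= trmxK; split=> -[XT XE]; split=> //.
    by apply/eqP; rewrite eq_sym -subr_eq0 addrAC; apply/eqP.
  by rewrite addrAC; apply/eqP; rewrite subr_eq0; apply/eqP.
exists S, P; split=> //.
  by split=> [|X /isPE]; [apply/isPE; case: hP|case: hP => _; apply].
have [[/trmx_symmetric ST SE] _] := hS.
have [[/trmx_symmetric PT PE] _] := hP.
(* Si equals ulsubmx S, but this form makes its Stein equation immediate *)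
pose Si := alpha *: (H *m S *m H^T) + z *m z^T.
pose Pi := G^T *m P *m G.
have SG : S = G *m Si *m G^T.
  rewrite {1}SE augmentedE trmx_mul /Si mulmxDr mulmxDl -scalemxAr -scalemxAl.
  by rewrite !mulmxA.
have SiE : Si = alpha *: ((A + B *m F) *m Si *m (A + B *m F)^T) + z *m z^T.
  by rewrite {1}/Si {1}SG -HG trmx_mul !mulmxA.
have PH : P = alpha *: (H^T *m Pi *m H) + Lambda Q R.
  by rewrite {1}PE trmxK augmentedE trmx_mul /Pi !mulmxA.
have PiE : Pi = alpha *: ((A + B *m F)^T *m Pi *m (A + B *m F))
    + closed_loop_weight Q R F.
  rewrite {1}/Pi {1}PH mulmxDr mulmxDl Lambda_congr -HG trmx_mul.
  by rewrite -scalemxAr -scalemxAl !mulmxA.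
have PiT : Pi^T = Pi by rewrite /Pi !trmx_mul trmxK PT mulmxA.
have SiT : Si^T = Si.
  by rewrite /Si linearD linearZ /= !trmx_mul !trmxK ST mulmxA.
have Sblock : S = block_mx Si (Si *m F^T) (F *m Si) (F *m Si *m F^T).
  by rewrite SG /G tr_col_mx trmx1 mul_col_mx mul_col_row mul1mx !mulmx1.
have Pblock : P = block_mx (alpha *: (A^T *m Pi *m A) + Q)
    (alpha *: (A^T *m Pi *m B)) (alpha *: (B^T *m Pi *m A))
    (alpha *: (B^T *m Pi *m B) + R).
  rewrite PH /H tr_row_mx mul_col_mx mul_col_row /Lambda scale_block_mx.
  by rewrite add_block_mx !addr0.
have := cost_gradient alpha01 RT hM PiT PiE SiE.
suff -> : 2 *: ((R *m F + alpha *: (B^T *m Pi *m (A + B *m F))) *m Si) =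
    2%:R *: ((ursubmx P)^T *m ulsubmx S)
    + 2%:R *: (drsubmx P *m (ursubmx S)^T) by [].
(* otherwise transposition rewrites would unfold both products *)
clearbody Si Pi; rewrite Pblock Sblock.
rewrite !(block_mxKur, block_mxKul, block_mxKdr) -scalerDr.
congr (_ *: _).
rewrite [(alpha *: _)^T]linearZ /= !trmx_mul !trmxK PiT SiT mulmxA.
rewrite mulmxDl !mulmxDr scalerDr !mulmxDl -!scalemxAl !mulmxA.
by rewrite addrCA [X in _ + X = _]addrC.
Qed.
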